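(* Let $D\in\mathbb{N}$, $c>0$ and $\varepsilon\in[0,1/4]$. There is a constant $K>0$ depending only on $D$, $c$ and $\varepsilon$ such that the following holds. Let $\mathcal{G}=\{G^{(t)}\}_{t=1}^{\infty}$ be a sequence of graphs on a common vertex set $V$ with $|V|=n\ge2$ such that each $G^{(t)}$ is regular, has degree at most $D$, and satisfies: for every $A\subseteq V$ with $1\le|A|\le n/2$, the number $|E(A,V\setminus A)|$ of edges of $G^{(t)}$ between $A$ and $V\setminus A$ is at least $c|A|^{\frac12+\varepsilon}$. Then, for the lazy random walk on $\mathcal{G}$: 1. $t_{\mathrm{mix}}(\mathcal{G})\le K n^{1-2\varepsilon}$. 2. For all $u,v\in V$ and $t\ge1$, $\left|p^{[0,t]}_{u,v}-\frac1n\right|\le \frac{K}{t^{1+2\varepsilon}}$. 3. $t_{\mathrm{hit}}(\mathcal{G})\le K n$ if $\varepsilon>0$, and $t_{\mathrm{hit}}(\mathcal{G})\le K n\log n$ if $\varepsilon=0$.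
   Context: All graphs are simple, undirected, unweighted. The lazy random walk on $\mathcal{G}=\{G^{(t)}\}_{t\ge1}$ is the time-inhomogeneous Markov chain whose $t$-th step uses the transition matrix $P^{(t)}$: $P^{(t)}(u,u)=1/2$, $P^{(t)}(u,v)=1/(2d_u)$ if $u,v$ are adjacent in $G^{(t)}$ (with $d_u$ the degree of $u$ in $G^{(t)}$), and $0$ otherwise. Here the common stationary distribution $\pi$ is uniform on $V$. $p^{[0,t]}_{u,v}=(P^{(1)}\cdots P^{(t)})(u,v)$, $\rho^{[0,t]}_{u,\cdot}=p^{[0,t]}_{u,\cdot}/\pi(\cdot)$, $\|f\|_{2,\pi}=\left(\sum_{x} f(x)^2\pi(x)\right)^{1/2}$. The ($\ell_2$) mixing time is $t_{\mathrm{mix}}(\mathcal{G})=\min\{t:\ \|\rho^{[0,t]}_{u,\cdot}-1\|_{2,\pi}\le 1/3 \text{ for all } u\in V\}$. The maximum hitting time is $t_{\mathrm{hit}}(\mathcal{G})=\max_{u,v}\tau_{u,v}$, where $\tau_{u,v}$ is the expected time for the walk started at $u$ at time $0$ to first reach $v$. *)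

(* Defs.v *)
From HB Require Import structures.
From mathcomp Require Import all_boot all_order all_algebra.
From mathcomp Require Import all_classical all_reals all_analysis.

Set Implicit Arguments.
Unset Strict Implicit.
Unset Printing Implicit Defensive.

Import Order.TTheory GRing.Theory Num.Theory.

Local Open Scope classical_set_scope.
Local Open Scope ring_scope.

Record sgraph (V : finType) := SGraph {
  adj : rel V;
  adj_sym : symmetric adj;
  adj_irrefl : irreflexive adj }.

Definition deg (V : finType) (g : sgraph V) (u : V) : nat := #|adj g u|.

Definition regular (V : finType) (g : sgraph V) (d : nat) : Prop :=
  forall u, deg g u = d.

(* Every edge {x, y} with exactly one endpoint in A is counted once, as the
   ordered pair whose first component is in A. *)
Definition edge_boundary (V : finType) (g : sgraph V) (A : {set V}) : nat :=
  #|[pred e : V * V | [&& e.1 \in A, e.2 \notin A & adj g e.1 e.2]]|.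

Section LazyWalk.
Variables (R : realType) (V : finType).

Definition lazy_step (g : sgraph V) (u v : V) : R :=
  if u == v then 2^-1
  else if adj g u v then (2 * (deg g u)%:R)^-1 else 0.

Definition lazy_mx (g : sgraph V) : 'M[R]_#|V| :=
  \matrix_(i, j) lazy_step g (enum_val i) (enum_val j).

(* A sequence G^(1), G^(2), ... is encoded as G : nat -> sgraph V; the graph
   G 0 is never used. *)
Implicit Type G : nat -> sgraph V.

Fixpoint lazy_mx_prod G (t : nat) : 'M[R]_#|V| :=
  if t is s.+1 then lazy_mx_prod G s *m lazy_mx (G s.+1) else 1%:M.

Definition tprob G (t : nat) (u v : V) : R :=
  lazy_mx_prod G t (enum_rank u) (enum_rank v).

Definition stat_pi (v : V) : R := #|V|%:R^-1.

Definition rho G (t : nat) (u v : V) : R := tprob G t u v / stat_pi v.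

Definition l2norm_pi (f : V -> R) : R :=
  Num.sqrt (\sum_(x : V) f x ^+ 2 * stat_pi x).

(* The value is +oo when no such t exists. *)
Definition tmix G : \bar R :=
  ereal_inf [set (t%:R)%:E | t in
    [set t : nat | forall u : V, l2norm_pi (fun v => rho G t u v - 1) <= 3^-1]].

Section Process.
Variables (d : measure_display) (Omega : measurableType d).
Variables (P : V -> probability Omega R) (X : nat -> Omega -> V).

Definition path_event (t : nat) (x : nat -> V) : set Omega :=
  [set w | forall i : nat, (i <= t)%N -> X i w = x i].

(* (X_t) is, for every u, a time-inhomogeneous Markov chain under P u which is
   started at u and whose step from time t to time t + 1 has transition matrix
   P^(t+1). The last clause is the Markov property multiplied out, so that no
   conditioning on null events occurs. *)
Definition lazy_random_walk G : Prop :=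
  [/\ forall (t : nat) (v : V), measurable (X t @^-1` [set v]),
      forall u : V, P u (X 0%N @^-1` [set u]) = 1%E &
      forall (u : V) (t : nat) (x : nat -> V),
        P u (path_event t.+1 x) =
        (P u (path_event t x) * (lazy_step (G t.+1) (x t) (x t.+1))%:E)%E].

(* First time, possibly 0, at which v is visited; +oo if there is none. *)
Definition hitting_time (v : V) (w : Omega) : \bar R :=
  ereal_inf [set (t%:R)%:E | t in [set t : nat | X t w = v]].

Definition expected_hitting_time (u v : V) : \bar R :=
  (\int[P u]_w hitting_time v w)%E.

Definition thit : \bar R :=
  \big[maxe/-oo%E]_(u : V) \big[maxe/-oo%E]_(v : V) expected_hitting_time u v.

End Process.
End LazyWalk.

(* Main.v *)
Require Import Defs.
From HB Require Import structures.
From mathcomp Require Import all_boot all_order all_algebra.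
From mathcomp Require Import all_classical all_reals all_analysis.
From mathcomp Require Import measurable_realfun.
From mathcomp Require Import ring lra zify.

Set Implicit Arguments.
Unset Strict Implicit.
Unset Printing Implicit Defensive.

Import Order.TTheory GRing.Theory Num.Theory.

Local Open Scope classical_set_scope.
Local Open Scope ring_scope.

(** The walk is compared with the uniform distribution in squared norm. A step
    of the lazy walk on a d-regular graph replaces f x by the mean of
    (f x + f y) / 2 over the neighbours y of x, so by convexity it lowers the
    squared norm by at least energy f / (4 d), where the energy is the sum of
    (f x - f y) ^ 2 over ordered pairs of neighbours ([sqnorm_step]). The energy
    is bounded below by a Nash inequality ([nash]): the coarea formula for f ^ 2
    turns a bound on the boundary of sets of bounded size into a spectral bound
    for functions with such a support ([coarea], [cheeger]); truncating a
    function of mass at most 1 at a quarter of its squared norm makes the support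
    small while keeping half of that norm ([nash_small_support]); and a median
    splits an arbitrary distribution into two functions supported on at most half
    of the vertices. With gam = 1 - 2 eps, the squared distance a to uniform
    therefore satisfies a' <= a - k a ^ (1 + gam) at each step, which forces
    a ^ gam to decay at least as fast as 1 / t ([power_recursion], [walk_decay]).
    As k depends on c and D only, changing the graph at each step is harmless.

    At time of order n ^ gam this makes a at most 1 / (9 n), which is the bound
    on the mixing time ([tmix_le]). The steps being symmetric, the kernel minus
    1 / n is an inner product of two centred distributions, obtained by running
    the first half of the steps backwards and the second half forwards; hence it
    is O(t ^ (- 1 / gam)), and 1 / gam >= 1 + 2 eps ([walk_pointwise],
    [kernel_decay]).

    For hitting times, consider a window of length 2 m n, where m is a constant
    such that all transition probabilities are at least 1 / (2 n) after time m n. The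
    expected number of visits to v in it is at least 1 / 2 ([visits_ge]), and
    from the first visit on it is at most B = 1 + 2 m + K sum_t t ^ -(1 + 2 eps)
    ([visits_le]). So v is hit in each window with probability at least
    1 / (2 B) ([survival_window]) and the expected hitting time is at most
    4 m n B ([expected_lifetime]). The sum is bounded if eps > 0, and of order
    log n if eps = 0. These estimates are about operators; they are transferred to
    the given process by expanding the event that v is avoided one step at a time
    ([path_event_avoid]). *)

(** * Energy dissipation and Cheeger's inequality *)

Section Functions.
Variables (R : realType) (V : finType).
Implicit Types (f : V -> R) (g : sgraph V).

Definition sqnorm f : R := \sum_x f x ^+ 2.

Definition energy g f : R := \sum_x \sum_(y | adj g x y) (f x - f y) ^+ 2.

Definition excess f (a : R) (x : V) : R := Num.max 0 (f x - a).

Definition step g f (x : V) : R := \sum_y lazy_step R g x y * f y.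

Lemma sqnorm_ge0 f : 0 <= sqnorm f.
Proof. by apply: sumr_ge0 => x _; rewrite sqr_ge0. Qed.

Lemma energy_ge0 g f : 0 <= energy g f.
Proof. by apply: sumr_ge0 => x _; apply: sumr_ge0 => y _; rewrite sqr_ge0. Qed.

Lemma excess_ge0 f a x : 0 <= excess f a x.
Proof. by rewrite /excess le_max lexx. Qed.

Lemma excess_gt0 f a x : (0 < excess f a x) = (a < f x).
Proof. by rewrite /excess lt_max ltxx subr_gt0. Qed.

Section Regular.
Variables (g : sgraph V) (d : nat).
Hypotheses (d_gt0 : (0 < d)%N) (reg : regular g d).

Let d0 : 0 < d%:R :> R. Proof. by rewrite ltr0n. Qed.

Lemma sum_neighbours_const x (a : R) : \sum_(y | adj g x y) a = d%:R * a.
Proof.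
by rewrite sumr_const mulr_natl -(reg x).
Qed.

Lemma sum_edges_fst f : \sum_x \sum_(y | adj g x y) f x = d%:R * \sum_x f x.
Proof.
by rewrite mulr_sumr; apply: eq_bigr => x _; rewrite sum_neighbours_const.
Qed.

Lemma sum_edges_snd f : \sum_x \sum_(y | adj g x y) f y = d%:R * \sum_x f x.
Proof.
rewrite (exchange_big_dep xpredT) //= -sum_edges_fst.
apply: eq_bigr => x _; apply: eq_bigl => y; exact: adj_sym.
Qed.

(** The loop of weight 1/2 is shared out among the d neighbours. *)
Lemma stepE f x : step g f x = d%:R^-1 * \sum_(y | adj g x y) (f x + f y) / 2.
Proof.
rewrite /step (bigD1 x) //= {1}/lazy_step eqxx.
have -> : \sum_(y | y != x) lazy_step R g x y * f y =
          \sum_(y | adj g x y) (2 * d%:R)^-1 * f y.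
  rewrite big_mkcond [RHS]big_mkcond /=; apply: eq_bigr => y _.
  rewrite /lazy_step eq_sym; have [->|xy] := eqVneq x y.
    by rewrite adj_irrefl.
  by rewrite /= (reg x); case: ifP; rewrite ?mul0r.
rewrite -mulr_suml big_split /= sum_neighbours_const -mulr_sumr.
by field; rewrite pnatr_eq0 -lt0n d_gt0.
Qed.

(** Jensen's inequality, as nonnegativity of the sum of the squared
    differences to the mean. *)
Lemma step_sqr f x :
  step g f x ^+ 2 <= d%:R^-1 * \sum_(y | adj g x y) ((f x + f y) / 2) ^+ 2.
Proof.
set m := step g f x.
have mE : \sum_(y | adj g x y) (f x + f y) / 2 = d%:R * m.
  by rewrite /m stepE mulrA divff ?mul1r // gt_eqF.
have : 0 <= \sum_(y | adj g x y) ((f x + f y) / 2 - m) ^+ 2.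
  by apply: sumr_ge0 => y _; rewrite sqr_ge0.
under eq_bigr do rewrite sqrrB.
rewrite !big_split /= sum_neighbours_const sumrN.
under [X in _ - X + _]eq_bigr do rewrite -mulrnAl -mulr_natr -mulrA.
rewrite -mulr_suml mE => h.
rewrite mulrC ler_pdivlMr //; nra.
Qed.

(** Sum [step_sqr] over x, using
    ((a + b) / 2) ^ 2 = a ^ 2 / 2 + b ^ 2 / 2 - (a - b) ^ 2 / 4 and the fact that each
    vertex is a neighbour of d others. *)
Lemma sqnorm_step f : sqnorm (step g f) <= sqnorm f - energy g f / (4 * d%:R).
Proof.
apply: (@le_trans _ _ (\sum_x
  d%:R^-1 * \sum_(y | adj g x y) ((f x + f y) / 2) ^+ 2)).
  by apply: ler_sum => x _; exact: step_sqr.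
rewrite -mulr_sumr.
have -> : \sum_x \sum_(y | adj g x y) ((f x + f y) / 2) ^+ 2 =
  2^-1 * (\sum_x \sum_(y | adj g x y) f x ^+ 2) +
  2^-1 * (\sum_x \sum_(y | adj g x y) f y ^+ 2) - 4^-1 * energy g f.
  rewrite !mulr_sumr -big_split -sumrB /=; apply: eq_bigr => x _.
  rewrite !mulr_sumr -big_split -sumrB /=; apply: eq_bigr => y _.
  by field.
rewrite (sum_edges_fst (fun x => f x ^+ 2)) (sum_edges_snd (fun x => f x ^+ 2)).
rewrite -/(sqnorm f) le_eqVlt; apply/orP; left; apply/eqP.
by field; rewrite pnatr_eq0 -lt0n d_gt0.
Qed.

Lemma edge_boundaryE (A : {set V}) :
  (edge_boundary g A)%:R =
  \sum_x \sum_(y | adj g x y) ((x \in A) && (y \notin A))%:R :> R.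
Proof.
rewrite /edge_boundary -sum1_card natr_sum pair_big_dep /=.
rewrite [RHS](bigID (fun e => (e.1 \in A) && (e.2 \notin A))) /=.
rewrite [X in _ + X]big1 ?addr0; last by move=> e /andP[_ /negbTE ->].
apply: eq_big => [e|e]; rewrite inE; last by case/and3P=> -> ->.
by case: (_ \in _); case: (_ \in _); case: (adj _ _ _).
Qed.

(** Discrete coarea formula, by induction on the support: subtracting the
    smallest positive value m from h peels off one level set A, which accounts
    for m times the boundary of A on the right and m times its size on the
    left. *)
Lemma coarea (theta : R) f :
  (forall x, 0 <= f x) ->
  (forall A : {set V}, (0 < #|A|)%N -> (forall x, x \in A -> 0 < f x) ->
     theta * #|A|%:R <= (edge_boundary g A)%:R) ->
  theta * \sum_x f x <=
  \sum_x \sum_(y | adj g x y) Num.max 0 (f x - f y).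
Proof.
have [n] := ubnP #|[set x | 0 < f x]%SET|; elim: n => // n IH in f *.
set A := [set x | 0 < f x]%SET => ltAn f0 iso.
have inA x : (x \in A) = (0 < f x) by rewrite /A inE.
have supp x : x \notin A -> f x = 0.
  by rewrite inA -leNgt => h; apply/eqP; rewrite eq_le h f0.
have [A0|/finset.set0Pn[x1 x1A]] := eqVneq A finset.set0.
  rewrite big1 ?mulr0; last by move=> x _; apply: supp; rewrite A0 finset.in_set0.
  by apply: sumr_ge0 => x _; apply: sumr_ge0 => y _; rewrite le_max lexx.
(* m is the height of the layer that is peeled off. *)
have [x0 x0A mP] := arg_minP f x1A; set m := f x0.
have m0 : 0 < m by rewrite -inA.
pose f' x := if x \in A then f x - m else 0.
have f'0 x : 0 <= f' x.
  by rewrite /f'; case: ifP => // xA; rewrite subr_ge0 mP.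
have sub x : 0 < f' x -> x \in A /\ x != x0.
  rewrite /f'; case: ifP => [xA|]; last by rewrite ltxx.
  by rewrite subr_gt0 => h; split=> //; apply: contraTneq h => ->; rewrite ltxx.
have fE x : f x = m * (x \in A)%:R + f' x.
  rewrite /f'; case: ifP => [_|/negbT/supp ->]; last by rewrite mulr0 addr0.
  by rewrite mulr1 addrC subrK.
have IH' : theta * \sum_x f' x <=
  \sum_x \sum_(y | adj g x y) Num.max 0 (f' x - f' y).
  apply: IH => //.
    apply: leq_trans (ltnSE ltAn); apply: proper_card.
    apply/properP; split; first by apply/fintype.subsetP => x; rewrite inE => /sub[].
    by exists x0 => //; apply/negP; rewrite inE => /sub[_]; rewrite eqxx.
  move=> B B0 Bf'; apply: iso => // x /Bf' /sub[]; by rewrite inA.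
have isoA : theta * #|A|%:R <= (edge_boundary g A)%:R.
  apply: iso => [|x]; last by rewrite inA.
  by apply/card_gt0P; exists x1.
have -> : \sum_x \sum_(y | adj g x y) Num.max 0 (f x - f y) =
  m * (edge_boundary g A)%:R +
  \sum_x \sum_(y | adj g x y) Num.max 0 (f' x - f' y).
  rewrite edge_boundaryE mulr_sumr -big_split /=; apply: eq_bigr => x _.
  rewrite mulr_sumr -big_split /=; apply: eq_bigr => y _.
  rewrite !fE; have [xA|xA] := boolP (x \in A); have [yA|yA] := boolP (y \in A).
  - by rewrite /= mulr0 add0r; congr Num.max; ring.
  - rewrite /f' (negbTE yA) /= !mulr1 mulr0 add0r !subr0.
    move: (f'0 x); rewrite /f' xA => h.
    by rewrite !max_r //; lra.
  - rewrite /f' (negbTE xA) yA /= mulr0 mulr1 add0r.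
    by move: (mP _ yA); rewrite -/m => h; rewrite !max_l //; lra.
  - by rewrite /f' (negbTE xA) (negbTE yA) /= mulr0 !add0r.
have -> : \sum_x f x = m * #|A|%:R + \sum_x f' x.
  under eq_bigr do rewrite fE.
  rewrite big_split /= -mulr_sumr; congr (m * _ + _).
  by rewrite -natr_sum -sum1_card [in RHS]big_mkcond.
nra.
Qed.

(** Cheeger's inequality: the coarea formula for f^2, where
    f x ^ 2 - f y ^ 2 = (f x - f y) (f x + f y) is split by the arithmetic-geometric
    mean inequality with weight theta / (4 d), so that the term in (f x + f y)^2
    absorbs half of the left-hand side. *)
Lemma cheeger (theta : R) f : 0 < theta ->
  (forall x, 0 <= f x) ->
  (forall A : {set V}, (0 < #|A|)%N -> (forall x, x \in A -> 0 < f x) ->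
     theta * #|A|%:R <= (edge_boundary g A)%:R) ->
  theta ^+ 2 / (4 * d%:R) * sqnorm f <= energy g f.
Proof.
move=> t0 f0 iso.
have /coarea : forall x, 0 <= f x ^+ 2 by move=> x; rewrite sqr_ge0.
move=> /(_ theta).
have h (A : {set V}) : (0 < #|A|)%N -> (forall x, x \in A -> 0 < f x ^+ 2) ->
    theta * #|A|%:R <= (edge_boundary g A)%:R.
  move=> A0 Af; apply: iso => // x /Af; rewrite lt0r sqrf_eq0 => /andP[fx _].
  by rewrite lt0r fx f0.
move=> /(_ h) {h}; rewrite -/(sqnorm f).
set l := theta / (4 * d%:R).
have l0 : 0 < l by rewrite divr_gt0 // mulr_gt0.
have lE : theta = 4 * d%:R * l by rewrite /l; field; rewrite gt_eqF.
move=> h1.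
have h2 : \sum_x \sum_(y | adj g x y) Num.max 0 (f x ^+ 2 - f y ^+ 2) <=
  (2 * l)^-1 * energy g f + (l * (\sum_x \sum_(y | adj g x y) f x ^+ 2) +
    l * (\sum_x \sum_(y | adj g x y) f y ^+ 2)).
  rewrite !mulr_sumr -!big_split /=; apply: ler_sum => x _.
  rewrite !mulr_sumr -!big_split /=; apply: ler_sum => y _.
  have e0 : 0 <= (2 * l)^-1 * (f x - f y) ^+ 2.
    by rewrite mulr_ge0 ?sqr_ge0 // invr_ge0 mulr_ge0 // ltW.
  rewrite ge_max; apply/andP; split.
    by rewrite addr_ge0 // addr_ge0 // mulr_ge0 ?sqr_ge0 // ltW.
  move: (f x) (f y) => u v.
  rewrite -subr_ge0.
  have -> : (2 * l)^-1 * (u - v) ^+ 2 + (l * u ^+ 2 + l * v ^+ 2) -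
      (u ^+ 2 - v ^+ 2) =
    (2 * l)^-1 * (u - v - l * (u + v)) ^+ 2 + l / 2 * (u - v) ^+ 2.
    by field; rewrite gt_eqF.
  by rewrite addr_ge0 // mulr_ge0 ?sqr_ge0 // ?invr_ge0 ?divr_ge0 ?mulr_ge0 // ltW.
move: h2; rewrite (sum_edges_fst (fun x => f x ^+ 2)).
rewrite (sum_edges_snd (fun x => f x ^+ 2)) -/(sqnorm f) => h2.
have h3 := le_trans h1 h2.
have h4 : 2 * d%:R * l * sqnorm f * (2 * l) <= energy g f.
  have l2 : 0 < 2 * l by rewrite mulr_gt0.
  rewrite -ler_pdivlMr // [leRHS]mulrC.
  by move: h3; rewrite lE; lra.
rewrite lE; have -> : (4 * d%:R * l) ^+ 2 / (4 * d%:R) = 4 * d%:R * l ^+ 2.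
  by field; rewrite gt_eqF.
by move: h4; set S := sqnorm f; set E := energy g f; lra.
Qed.

End Regular.
End Functions.

(** * Nash inequality on isoperimetric graphs *)

Section Nash.
Variables (R : realType) (V : finType).
Implicit Types (f : V -> R) (g : sgraph V).

Definition isoperimetric (c s : R) g : Prop :=
  forall A : {set V}, (1 <= #|A|)%N -> #|A|%:R <= #|V|%:R / 2 :> R ->
    c * #|A|%:R `^ s <= (edge_boundary g A)%:R.

Definition deviation f : R := sqnorm (fun x => f x - #|V|%:R^-1).

Lemma deviation_ge0 f : 0 <= deviation f.
Proof. exact: sqnorm_ge0. Qed.

Lemma powR1D (a r : R) : 0 <= a -> 0 <= r -> a `^ (1 + r) = a * a `^ r.
Proof.
move=> a0 r0; rewrite powRD ?powRr1 // (_ : (1 + r == 0) = false) //.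
by apply: gt_eqF; lra.
Qed.

(** Truncation is 1-Lipschitz. *)
Lemma energy_excess g f a : energy g (excess f a) <= energy g f.
Proof.
apply: ler_sum => x _; apply: ler_sum => y _; rewrite /excess.
move: (f x) (f y) => u v.
by have := sqr_ge0 (u - v); case: (leP 0 (u - a)) => h1;
  case: (leP 0 (v - a)) => h2 h3; nra.
Qed.

(** Across an edge the positive and negative parts of f - a vary in the same
    direction, so the cross term of the square is nonnegative. *)
Lemma energy_split g f a :
  energy g (excess f a) + energy g (excess (fun x => - f x) (- a)) <=
  energy g f.
Proof.
rewrite -big_split; apply: ler_sum => x _ /=; rewrite -big_split /=.
apply: ler_sum => y _; rewrite /excess; move: (f x) (f y) => u v.
by case: (leP 0 (u - a)) => h1; case: (leP 0 (v - a)) => h2;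
  case: (leP 0 (- u - - a)) => h3; case: (leP 0 (- v - - a)) => h4; nra.
Qed.

Lemma sqnorm_split f a :
  sqnorm (excess f a) + sqnorm (excess (fun x => - f x) (- a)) =
  sqnorm (fun x => f x - a).
Proof.
rewrite -big_split; apply: eq_bigr => x _ /=; rewrite /excess.
have [h|/ltW h] := leP a (f x).
  by rewrite max_r ?max_l ?subr_ge0 ?subr_le0 ?lerN2 //; ring.
by rewrite max_l ?max_r ?subr_ge0 ?subr_le0 ?lerN2 //; ring.
Qed.

(** The mean 1 / n minimises the quadratic distance to a constant. *)
Lemma deviation_min f a : (0 < #|V|)%N -> \sum_x f x = 1 ->
  deviation f <= sqnorm (fun x => f x - a).
Proof.
move=> V0 f1; set n := #|V|%:R : R.
have n0 : n != 0 by rewrite pnatr_eq0 -lt0n.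
have -> : sqnorm (fun x => f x - a) =
    deviation f + 2 * (n^-1 - a) * (\sum_x f x - \sum_(x : V) n^-1) +
    \sum_(x : V) (n^-1 - a) ^+ 2.
  rewrite -sumrB mulr_sumr -!big_split /=; apply: eq_bigr => x _.
  by rewrite -/n; ring.
rewrite f1 [X in 1 - X]sumr_const -[X in 1 - X]mulr_natl -/n divff // subrr mulr0.
by rewrite addr0 lerDl sumr_ge0 // => x _; rewrite sqr_ge0.
Qed.

(** Among the values of f with at most half of the points above, take the
    least one. *)
Lemma median f : (0 < #|V|)%N -> exists x0 : V,
  (2 * #|[set x | (f x0 < f x)%R]%SET| <= #|V|)%N /\
  (2 * #|[set x | (f x < f x0)%R]%SET| <= #|V|)%N.
Proof.
move=> /card_gt0P[v _].
pose P (x : V) := (2 * #|[set y | (f x < f y)%R]%SET| <= #|V|)%N.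
have [x1 _ x1P] := @arg_maxP _ _ _ v xpredT f isT.
have Px1 : P x1.
  rewrite /P (_ : [set y | _]%SET = finset.set0) ?cards0 //.
  by apply/setP => y; rewrite !inE ltNge; apply/negbF; apply: x1P.
have [x0 Px0 x0P] := @arg_minP _ _ _ x1 P f Px1; exists x0; split=> //.
have [B0|/finset.set0Pn[y1]] := eqVneq [set x | f x < f x0]%SET finset.set0.
  by rewrite B0 cards0.
rewrite inE => y1B; have [y yB yP] := @arg_maxP _ _ _ y1 (fun x => f x < f x0) f y1B.
have nPy : ~~ P y by apply/negP => /x0P; rewrite leNgt yB.
have : (#|[set x | (f x < f x0)%R]%SET| <= #|~: [set z | (f y < f z)%R]%SET|)%N.
  apply/subset_leq_card/fintype.subsetP => z.
  by rewrite !inE -leNgt; apply: yP.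
have := cardsC [set z | f y < f z]%SET; move: nPy; rewrite /P.
move: #|_| #|_| #|_| #|_| => a b e h; lia.
Qed.

Variables (g : sgraph V) (d : nat) (c eps : R).
Hypotheses (d_gt0 : (0 < d)%N) (reg : regular g d).
Hypotheses (c_gt0 : 0 < c) (eps_ge0 : 0 <= eps) (eps_le : eps <= 4^-1).
Hypothesis iso : isoperimetric c (2^-1 + eps) g.

Let d0 : 0 < d%:R :> R. Proof. by rewrite ltr0n. Qed.

(** Truncating at level b / 4, where b is the squared norm of f, keeps half of b
    and leaves a support of size at most 4 / b, on which the isoperimetric
    profile gives a Cheeger constant of order b ^ (1/2 - eps). *)
Lemma nash_small_support f :
  (forall x, 0 <= f x) -> \sum_x f x <= 1 ->
  (2 * #|[set x | (0 < f x)%R]%SET| <= #|V|)%N ->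
  c ^+ 2 / (32 * d%:R) * sqnorm f `^ (1 + (1 - 2 * eps)) <= energy g f.
Proof.
have [e0 e4] := (eps_ge0, eps_le).
move=> f0 f1 supp; set gam := 1 - 2 * eps; set b := sqnorm f.
have gam0 : 0 <= gam by rewrite /gam; lra.
have gam1 : gam <= 1 by rewrite /gam; lra.
have b0 : 0 <= b := sqnorm_ge0 f.
rewrite powR1D //; move: b0; rewrite le_eqVlt => /predU1P[<-|b0].
  by rewrite mul0r mulr0 energy_ge0.
(* The mass being at most 1, this level costs at most 2 z = b / 2. *)
set z := b / 4; have z0 : 0 < z by rewrite divr_gt0.
set f' := excess f z.
have half : b / 2 <= sqnorm f'.
  have : \sum_x (f x ^+ 2 - 2 * z * f x) <= sqnorm f'.
    apply: ler_sum => x _; rewrite /f' /excess.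
    move: (f0 x) (sqr_ge0 z) => fx0 z2; case: (leP 0 (f x - z)) => h; first nra.
    by have := mulr_ge0 fx0 (ltW z0); nra.
  rewrite sumrB -mulr_sumr -/(sqnorm f) -/b => h.
  suff : 2 * z * \sum_x f x <= b / 2 by lra.
  by rewrite /z; nra.
set th := c * z `^ (2^-1 - eps).
have th0 : 0 < th by rewrite mulr_gt0 // powR_gt0.
have thE : th ^+ 2 = c ^+ 2 * z `^ gam.
  rewrite exprMn -(powR_mulrn 2 (powR_ge0 _ _)) -powRrM; congr (_ * _ `^ _).
  by rewrite /gam; field.
(* On the support of f', A has size at most 1 / z, whence the constant th. *)
have chg : th ^+ 2 / (4 * d%:R) * sqnorm f' <= energy g f'.
  apply: cheeger => // [x|A A0 Af']; first exact: excess_ge0.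
  have Af x : x \in A -> z < f x by move=> /Af'; rewrite excess_gt0.
  have zA : z * #|A|%:R <= 1.
    apply: le_trans f1; rewrite (bigID (mem A)) /= mulr_natr -sumr_const.
    rewrite -[leLHS]addr0 lerD ?sumr_ge0 //.
    by apply: ler_sum => x /Af /ltW.
  have A0' : 0 < #|A|%:R :> R by rewrite ltr0n.
  apply: le_trans (iso A0 _); last first.
    rewrite ler_pdivlMr // -natrM ler_nat mulnC.
    apply: leq_trans supp; rewrite leq_mul2l /=.
    apply/subset_leq_card/fintype.subsetP => x /Af h.
    by rewrite inE (lt_trans z0).
  rewrite /th -mulrA ler_pM2l //.
  have AE : #|A|%:R = #|A|%:R `^ (2^-1 - eps) * #|A|%:R `^ (2^-1 + eps) :> R.
    rewrite -powRD ?(gt_eqF A0') ?implybT //.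
    by rewrite (_ : _ + _ = 1) ?powRr1 ?(ltW A0') //; field.
  rewrite [X in _ * X <= _]AE mulrA -powRM ?(ltW z0) ?(ltW A0') //.
  rewrite -[leRHS]mul1r ler_wpM2r ?powR_ge0 //.
  apply: (@le_trans _ _ (1 `^ (2^-1 - eps))); last by rewrite powR1.
  apply: ge0_ler_powR; rewrite ?nnegrE ?mulr_ge0 ?(ltW z0) //; lra.
apply: le_trans (energy_excess g f z); apply: le_trans chg.
rewrite thE; have zb : 4^-1 * b `^ gam <= z `^ gam.
  rewrite /z [b / 4]mulrC powRM ?invr_ge0 ?(ltW b0) //.
  by rewrite ler_wpM2r ?powR_ge0 // ger1_powR //; lra.
have p0 : 0 <= b `^ gam by rewrite powR_ge0.
have -> : c ^+ 2 / (32 * d%:R) * (b * b `^ gam) =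
   (c ^+ 2 / (4 * d%:R)) * ((4^-1 * b `^ gam) * (b / 2)).
  by field; rewrite gt_eqF.
have -> : c ^+ 2 * z `^ gam / (4 * d%:R) * sqnorm f' =
   (c ^+ 2 / (4 * d%:R)) * (z `^ gam * sqnorm f').
  by field; rewrite gt_eqF.
rewrite ler_wpM2l ?divr_ge0 ?sqr_ge0 ?mulr_ge0 ?(ltW d0) //.
by rewrite ler_pM // ?mulr_ge0 ?divr_ge0 // ltW.
Qed.

(** The positive and negative parts of f - m, for m a median of f, both have
    support at most half of V and mass at most 1: for the negative part, m times
    the size of its support is at most the mass of f at or above m. *)
Lemma nash f : (0 < #|V|)%N ->
  (forall x, 0 <= f x) -> \sum_x f x = 1 ->
  c ^+ 2 / (128 * d%:R) * deviation f `^ (1 + (1 - 2 * eps)) <= energy g f.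
Proof.
have [e0 e4] := (eps_ge0, eps_le).
move=> V0 f0 f1; set p := 1 + (1 - 2 * eps).
have p0 : 0 <= p by rewrite /p; lra.
have p2 : p <= 2 by rewrite /p; lra.
have [x0 [up lo]] := median f V0; set m := f x0.
have m0 : 0 <= m := f0 x0.
set fp := excess f m; set fm := excess (fun x => - f x) (- m).
have hp : c ^+ 2 / (32 * d%:R) * sqnorm fp `^ p <= energy g fp.
  apply: nash_small_support => [x||]; first exact: excess_ge0.
    rewrite -f1; apply: ler_sum => x _; rewrite /fp /excess.
    by move: (f0 x) => ?; case: (leP 0 (f x - m)) => ?; lra.
  by under eq_finset do rewrite excess_gt0.
have fm_gt0 x : (0 < fm x) = (f x < m) by rewrite excess_gt0 ltrN2.
have hm : c ^+ 2 / (32 * d%:R) * sqnorm fm `^ p <= energy g fm.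
  apply: nash_small_support => [x||]; first exact: excess_ge0.
    apply: (@le_trans _ _ (\sum_(x in [set x | f x < m]%SET) m)).
      rewrite [leRHS]big_mkcond; apply: ler_sum => x _ /=; rewrite inE /fm /excess.
      by move: (f0 x) => ?; case: (ltP (f x) m) => ?; case: (leP 0 (- f x - - m)) => ?; lra.
    apply: (@le_trans _ _ (\sum_(x in ~: [set x | f x < m]%SET) f x)); last first.
      rewrite -f1 [leRHS](bigID (mem (~: [set x | f x < m]%SET))) /=.
      by rewrite lerDl sumr_ge0.
    apply: (@le_trans _ _ (\sum_(x in ~: [set x | f x < m]%SET) m)); last first.
      by apply: ler_sum => x; rewrite !inE -leNgt.
    rewrite !sumr_const -[leLHS]mulr_natl -[leRHS]mulr_natl ler_wpM2r // ler_nat.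
    by have := cardsC [set x | f x < m]%SET; move: lo; rewrite -/m; lia.
  by under eq_finset do rewrite fm_gt0.
apply: le_trans (energy_split g f m); apply: le_trans (lerD hp hm).
rewrite -mulrDr.
have := deviation_min m V0 f1; rewrite -sqnorm_split -/fp -/fm.
move: (deviation_ge0 f) (sqnorm_ge0 fp) (sqnorm_ge0 fm).
move: (deviation f) (sqnorm fp) (sqnorm fm) => a u v a0 u0 v0 auv.
have pq : 4^-1 * a `^ p <= (a / 2) `^ p.
  rewrite [a / 2]mulrC powRM ?invr_ge0 // ler_wpM2r ?powR_ge0 //.
  have -> : 4^-1 = 2^-1 `^ 2 :> R by rewrite powR_mulrn //; field.
  by apply: ger_powR => //; lra.
have key : (a / 2) `^ p <= u `^ p + v `^ p.
  have [uv|uv] := leP u v.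
    apply: (@le_trans _ _ (v `^ p)); last by rewrite lerDr powR_ge0.
    by apply: ge0_ler_powR; rewrite ?nnegrE //; lra.
  apply: (@le_trans _ _ (u `^ p)); last by rewrite lerDl powR_ge0.
  by apply: ge0_ler_powR; rewrite ?nnegrE //; lra.
have -> : c ^+ 2 / (128 * d%:R) * a `^ p =
   c ^+ 2 / (32 * d%:R) * (4^-1 * a `^ p) by field; rewrite gt_eqF.
rewrite ler_wpM2l ?divr_ge0 ?sqr_ge0 ?mulr_ge0 ?(ltW d0) //.
exact: le_trans pq key.
Qed.

End Nash.

(** * Decay of the distance to uniform *)

Section Walk.
Variables (R : realType) (V : finType).
Implicit Types (f h : V -> R) (g : sgraph V) (gs : seq (sgraph V)).

Definition walk gs f : V -> R := foldr (@step R V) f gs.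

Definition point (v : V) : V -> R := fun x => (x == v)%:R.

Lemma point_ge0 v x : 0 <= point v x.
Proof. exact: ler0n. Qed.

Lemma sum_point v f : \sum_x f x * point v x = f v.
Proof.
rewrite (bigD1 v) //= /point eqxx mulr1 big1 ?addr0 // => x /negbTE ->.
by rewrite mulr0.
Qed.

Lemma sum_point1 v : \sum_x point v x = 1.
Proof.
by rewrite -[RHS](sum_point v (fun=> 1)); apply: eq_bigr => x _; rewrite mul1r.
Qed.

Lemma lazy_step_ge0 g x y : 0 <= lazy_step R g x y.
Proof.
by rewrite /lazy_step; case: ifP => _; [|case: ifP => _];
  rewrite ?invr_ge0 ?mulr_ge0.
Qed.

Lemma step_le g f h : (forall x, f x <= h x) ->
  forall x, step g f x <= step g h x.
Proof.
by move=> fh x; apply: ler_sum => y _; rewrite ler_wpM2l ?lazy_step_ge0.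
Qed.

Lemma step_ge0 g f : (forall x, 0 <= f x) -> forall x, 0 <= step g f x.
Proof.
by move=> f0 x; apply: sumr_ge0 => y _; rewrite mulr_ge0 ?lazy_step_ge0.
Qed.

Lemma stepD g f h x : step g (fun y => f y + h y) x = step g f x + step g h x.
Proof. by rewrite -big_split; apply: eq_bigr => y _; rewrite mulrDr. Qed.

Lemma stepZ g (a : R) f x : step g (fun y => a * f y) x = a * step g f x.
Proof. by rewrite mulr_sumr; apply: eq_bigr => y _; rewrite mulrCA. Qed.

Lemma walk_ge0 gs f : (forall x, 0 <= f x) -> forall x, 0 <= walk gs f x.
Proof. by move=> f0; elim: gs => //= g gs IH x; apply: step_ge0. Qed.

Lemma walk_cat gs1 gs2 f : walk (gs1 ++ gs2) f = walk gs1 (walk gs2 f).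
Proof. exact: foldr_cat. Qed.

Definition regular_pos g : Prop := exists2 d, (0 < d)%N & regular g d.

Lemma step_const g (a : R) x : regular_pos g -> step g (fun=> a) x = a.
Proof.
move=> [d d0 reg]; rewrite (stepE d0 reg) (sum_neighbours_const reg).
by field; rewrite pnatr_eq0 -lt0n.
Qed.

Lemma step_adjoint g f h : regular_pos g ->
  \sum_x step g f x * h x = \sum_x f x * step g h x.
Proof.
move=> [d d0 reg]; under eq_bigr do rewrite mulr_suml.
under [RHS]eq_bigr do rewrite mulr_sumr.
rewrite exchange_big; apply: eq_bigr => x _; apply: eq_bigr => y _ /=.
rewrite mulrAC [RHS]mulrCA -mulrA; congr (_ * _); last exact: mulrC.
by rewrite /lazy_step eq_sym adj_sym (reg x) (reg y).
Qed.

Lemma sum_step g f : regular_pos g -> \sum_x step g f x = \sum_x f x.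
Proof.
move=> reg; have := step_adjoint f (fun=> 1) reg.
under eq_bigr do rewrite mulr1.
by move=> ->; apply: eq_bigr => x _; rewrite step_const // mulr1.
Qed.

Lemma deviationE f : (0 < #|V|)%N -> \sum_x f x = 1 ->
  deviation f = sqnorm f - #|V|%:R^-1.
Proof.
move=> V0 f1; rewrite /deviation /sqnorm; set n := #|V|%:R : R.
have n0 : n != 0 by rewrite pnatr_eq0 -lt0n.
under eq_bigr do rewrite sqrrB -mulr_natr -mulrA.
rewrite big_split sumrB /= -mulr_suml f1 mul1r sumr_const.
by rewrite -[X in _ + X]mulr_natl -/n; field.
Qed.

Section Admissible.
Variables (D : nat) (c eps : R).
Hypotheses (c_gt0 : 0 < c) (eps_ge0 : 0 <= eps) (eps_le : eps <= 4^-1).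

Definition admissible g : bool :=
  `[< exists d, [/\ (0 < d)%N, (d <= D)%N, regular g d &
                    isoperimetric c (2^-1 + eps) g] >].

Lemma admissible_regular g : admissible g -> regular_pos g.
Proof. by move=> /asboolP[d [d0 _ reg _]]; exists d. Qed.

Lemma sum_walk gs f : all admissible gs -> \sum_x walk gs f x = \sum_x f x.
Proof.
elim: gs => //= g gs IH /andP[ag ags].
by rewrite sum_step ?IH //; apply: admissible_regular.
Qed.

(** Each step is a symmetric operator, so transposing a product of steps
    reverses their order. *)
Lemma walk_adjoint gs f h : all admissible gs ->
  \sum_x walk gs f x * h x = \sum_x f x * walk (rev gs) h x.
Proof.
elim: gs f h => //= g gs IH f h /andP[ag ags].
rewrite step_adjoint ?IH //; last exact: admissible_regular.
by rewrite rev_cons -cats1 walk_cat.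
Qed.

(** The factor 32 ^ 2 dominates the 4 * 128 that come from [sqnorm_step] and
    [nash]; D.+1 and the minimum with 1 keep the constant in (0, 1] when c > 0. *)
Definition rate : R := Num.min 1 ((c / (32 * D.+1%:R)) ^+ 2).

Lemma rate_gt0 : 0 < rate.
Proof. by rewrite lt_min ltr01 exprn_gt0 // divr_gt0 // mulr_gt0. Qed.

Lemma rate_le1 : rate <= 1.
Proof. by rewrite /rate ge_min lexx. Qed.

(** The Nash inequality inserted in the energy dissipation of a step. *)
Lemma deviation_step g f : (0 < #|V|)%N -> admissible g ->
  (forall x, 0 <= f x) -> \sum_x f x = 1 ->
  deviation (step g f) <=
  deviation f - rate * (deviation f * deviation f `^ (1 - 2 * eps)).
Proof.
have [e0 e4] := (eps_ge0, eps_le).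
move=> V0 ag f0 f1; have rg := admissible_regular ag.
move: ag => /asboolP[d [d0 dD reg iso]].
have d0' : 0 < d%:R :> R by rewrite ltr0n.
rewrite -powR1D ?deviation_ge0 //; last lra.
have hn := nash d0 reg c_gt0 eps_ge0 eps_le iso V0 f0 f1.
rewrite [leLHS](deviationE V0); last by rewrite sum_step.
move: hn; set p := _ `^ _ => hn; rewrite (deviationE V0 f1).
have p0 : 0 <= p by rewrite powR_ge0.
have hs := sqnorm_step d0 reg f.
suff : rate * p <= energy g f / (4 * d%:R) by move: hs; lra.
rewrite ler_pdivlMr ?mulr_gt0 //; apply: le_trans hn.
have D0 : 0 < D.+1%:R :> R by rewrite ltr0n.
have dD' : d%:R <= D.+1%:R :> R by rewrite ler_nat leqW.
have hr : rate <= (c / (32 * d%:R)) ^+ 2.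
  rewrite ge_min; apply/orP; right.
  rewrite lerXn2r ?nnegrE ?divr_ge0 ?mulr_ge0 ?(ltW c_gt0) //.
  rewrite ler_wpM2l ?(ltW c_gt0) // lef_pV2 ?posrE ?mulr_gt0 //.
  by rewrite ler_wpM2l.
apply: (@le_trans _ _ ((c / (32 * d%:R)) ^+ 2 * p * (4 * d%:R))).
  by rewrite ler_wpM2r ?mulr_ge0 ?(ltW d0') // ler_wpM2r.
have -> : (c / (32 * d%:R)) ^+ 2 * p * (4 * d%:R) =
   2^-1 * (c ^+ 2 / (128 * d%:R) * p) by field; rewrite gt_eqF.
have : 0 <= c ^+ 2 / (128 * d%:R) * p.
  by rewrite mulr_ge0 // divr_ge0 ?sqr_ge0 ?mulr_ge0 ?(ltW d0').
move: (_ * p) => q; lra.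
Qed.

(** For x = a ^ gam the hypothesis on b reads b <= a (1 - k x); as gam >= 1/2,
    b ^ gam <= x (1 - k x) ^ (1/2) <= x (1 - k x / 2), so that 1 / x grows by at
    least k / 2. *)
Lemma power_recursion (gam k m a b : R) :
  2^-1 <= gam -> 0 < k -> k <= 1 -> 1 <= m -> 0 <= a -> 0 <= b ->
  b <= a - k * (a * a `^ gam) -> a `^ gam * m <= 1 ->
  b `^ gam * (m + k / 2) <= 1.
Proof.
move=> g2 k0 k1 m1 a0 b0 ba; set x := a `^ gam => xm.
have x0 : 0 <= x by rewrite powR_ge0.
have x1 : x <= 1 by nra.
have kx : 0 <= k * x by rewrite mulr_ge0 // ltW.
have kx1 : k * x <= 1 by nra.
have bx : b `^ gam <= x * (1 - k * x) `^ gam.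
  rewrite /x -powRM ?subr_ge0 //; apply: ge0_ler_powR; rewrite ?nnegrE //.
  - lra.
  - by rewrite mulr_ge0 // subr_ge0.
  - by move: ba; rewrite -/x; lra.
have w2 : (1 - k * x) `^ gam <= 1 - k * x / 2.
  have [->|w0] := eqVneq (k * x) 1.
    by rewrite subrr powR0 ?gt_eqF; lra.
  have w1 : 0 < 1 - k * x by rewrite subr_gt0 lt_neqAle w0.
  apply: (@le_trans _ _ ((1 - k * x) `^ 2^-1)).
    by apply: ger_powR => //; lra.
  rewrite powR12_sqrt ?(ltW w1) //; have := sqr_sqrtr (ltW w1).
  by move: (Num.sqrt _) (sqrtr_ge0 (1 - k * x)) => s s0 sE; nra.
have b2 : b `^ gam <= x * (1 - k * x / 2).
  by apply: le_trans bx _; rewrite ler_wpM2l.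
apply: (@le_trans _ _ (x * (1 - k * x / 2) * (m + k / 2))).
  by rewrite ler_wpM2r //; lra.
have -> : x * (1 - k * x / 2) * (m + k / 2) =
  x * m + k * x / 2 * (1 - x * m) - (k * x / 2) ^+ 2 by field.
have := sqr_ge0 (k * x / 2).
have : 0 <= (1 - k * x / 2) * (1 - x * m).
  by rewrite mulr_ge0 // subr_ge0 //; lra.
lra.
Qed.

Lemma walk_decay gs v : (0 < #|V|)%N -> all admissible gs ->
  deviation (walk gs (point v)) `^ (1 - 2 * eps) *
    (1 + rate / 2 * (size gs)%:R) <= 1.
Proof.
have [e0 e4] := (eps_ge0, eps_le); move=> V0; elim: gs => /= [_|g gs IH /andP[ag ags]].
  rewrite mulr0 addr0 mulr1.
  apply: (@le_trans _ _ (1 `^ (1 - 2 * eps))); last by rewrite powR1.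
  apply: ge0_ler_powR; rewrite ?nnegrE ?deviation_ge0 //; first lra.
  rewrite deviationE ?sum_point1 // /sqnorm.
  under eq_bigr do rewrite expr2.
  by rewrite sum_point /point eqxx lerBlDr lerDl invr_ge0.
have -> : 1 + rate / 2 * (size gs).+1%:R =
    1 + rate / 2 * (size gs)%:R + rate / 2.
  by rewrite -[(size gs).+1%:R]natr1; ring.
apply: (power_recursion (a := deviation (walk gs (point v)))) => //.
- lra.
- exact: rate_gt0.
- exact: rate_le1.
- by rewrite lerDl mulr_ge0 // divr_ge0 // ltW // rate_gt0.
- exact: deviation_ge0.
- exact: deviation_ge0.
- apply: deviation_step => //; first by apply: walk_ge0 => x; apply: point_ge0.
  by rewrite sum_walk // sum_point1.
- exact: IH.
Qed.

Lemma half_bounds (m : nat) :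
  (m <= 2 * m./2 + 1)%N /\ (m./2 <= m - m./2)%N.
Proof. by have := odd_double_half m; lia. Qed.

(** Splitting the walk in the middle writes its kernel minus 1/n as the inner
    product of two centred distributions, one for each half; the first half is
    run backwards, which the symmetry of the steps allows. *)
Lemma walk_pointwise gs u v : (0 < #|V|)%N -> all admissible gs ->
  (0 < size gs)%N ->
  `|walk gs (point v) u - #|V|%:R^-1| `^ (1 - 2 * eps) <=
  4 / rate / (size gs)%:R.
Proof.
have [e0 e4] := (eps_ge0, eps_le); move=> V0 ags s0.
have r0 := rate_gt0; have r1 := rate_le1.
set n := #|V|%:R : R; have [hk1 hk2] := half_bounds (size gs).
set k := (size gs)./2 in hk1 hk2 *.
have := ags; rewrite -{1}(cat_take_drop k gs) all_cat => /andP[at_ ad].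
pose P := walk (drop k gs) (point v); pose Q := walk (rev (take k gs)) (point u).
have P1 : \sum_x P x = 1 by rewrite sum_walk ?sum_point1.
have Q1 : \sum_x Q x = 1 by rewrite sum_walk ?sum_point1 ?all_rev.
have n0 : n != 0 by rewrite pnatr_eq0 -lt0n.
have PQ : walk gs (point v) u - n^-1 = \sum_x (P x - n^-1) * (Q x - n^-1).
  rewrite -{1}(cat_take_drop k gs) walk_cat -sum_point walk_adjoint // -/P -/Q.
  have -> : \sum_x (P x - n^-1) * (Q x - n^-1) = \sum_x P x * Q x -
      n^-1 * \sum_x P x - n^-1 * \sum_x Q x + \sum_(x : V) n^-1 ^+ 2.
    rewrite !mulr_sumr -!sumrB -big_split /=; apply: eq_bigr => x _; ring.
  by rewrite P1 Q1 sumr_const -[X in _ = _ + X]mulr_natl -/n; field.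
have hle : `|walk gs (point v) u - n^-1| <= (deviation P + deviation Q) / 2.
  rewrite PQ mulrC /deviation /sqnorm -big_split /= mulr_sumr.
  apply: le_trans (ler_norm_sum _ _ _) _; apply: ler_sum => x _; rewrite -/n.
  move: (P x - _) (Q x - _) => a b.
  by rewrite ler_norml; have := sqr_ge0 (a - b); have := sqr_ge0 (a + b);
    move=> h1 h2; apply/andP; split; nra.
have dec a (s : nat) : 0 <= a -> a `^ (1 - 2 * eps) * (1 + rate / 2 * s%:R) <= 1 ->
    (k <= s)%N -> a `^ (1 - 2 * eps) <= 4 / rate / (size gs)%:R.
  move=> a0 h ks; have p0 : 0 <= a `^ (1 - 2 * eps) by rewrite powR_ge0.
  rewrite ler_pdivlMr ?ltr0n // ler_pdivlMr //.
  have : (size gs)%:R <= 2 * s%:R + 1 :> R.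
    rewrite -natrM natr1 ler_nat; apply: leq_trans hk1 _.
    by rewrite addn1 ltnS leq_mul2l ks.
  have ss : 0 <= s%:R :> R by [].
  move: ss h => + + h3; move: (s%:R : R) (_ `^ _) p0 h3 => S A A0 h3 S0 h.
  have : 0 <= A * S by rewrite mulr_ge0.
  have : A * rate * (size gs)%:R <= A * rate * (2 * S + 1).
    by rewrite ler_wpM2l // mulr_ge0 // ltW.
  have : A * rate <= A by rewrite -[leRHS]mulr1 ler_wpM2l.
  move: h; nra.
have decP : deviation P `^ (1 - 2 * eps) <= 4 / rate / (size gs)%:R.
  apply: (dec _ (size (drop k gs))); [exact: deviation_ge0|exact: walk_decay|].
  by rewrite size_drop.
have decQ : deviation Q `^ (1 - 2 * eps) <= 4 / rate / (size gs)%:R.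
  apply: (dec _ (size (rev (take k gs)))); first exact: deviation_ge0.
    by apply: walk_decay => //; rewrite all_rev.
  rewrite size_rev size_take; case: ltnP => // _.
  exact: leq_trans hk2 (leq_subr _ _).
(* The kernel minus 1/n is at most the larger of the two deviations. *)
have [PQle|/ltW QPle] := leP (deviation P) (deviation Q).
  apply: le_trans decQ; apply: ge0_ler_powR; rewrite ?nnegrE ?deviation_ge0 //.
    lra.
  by apply: le_trans hle _; lra.
apply: le_trans decP; apply: ge0_ler_powR; rewrite ?nnegrE ?deviation_ge0 //.
  lra.
by apply: le_trans hle _; lra.
Qed.

End Admissible.
End Walk.

(** * Visits and survival of the walk *)

Section Hitting.
Variables (R : realType) (V : finType) (v : V).
Implicit Types (f h : V -> R) (g : sgraph V) (gs : seq (sgraph V)).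

(** The probability that the walk along gs, started at x, avoids v from time 0 to
    time size gs. *)
Definition survival gs : V -> R :=
  foldr (fun g f x => if x == v then 0 else step g f x)
        (fun x => (x != v)%:R) gs.

(** The expected number of times in 0, ..., size gs that the walk spends at v. *)
Definition visits gs : V -> R :=
  foldr (fun g f x => point R v x + step g f x) (point R v) gs.

(** With h the indicator of the complement of v, the expected number of times in
    0, ..., size gs up to which v has been avoided; a general h stands for
    the contribution of what follows gs. *)
Definition lifetime h gs : V -> R :=
  foldr (fun g f x => if x == v then 0 else 1 + step g f x) h gs.

Lemma survival_ge0 gs x : 0 <= survival gs x.
Proof.
elim: gs x => [x|g gs IH x] /=; first exact: ler0n.
by case: ifP => // _; apply: step_ge0.
Qed.

Lemma survival_le1 gs x : all (fun g => `[< regular_pos g >]) gs ->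
  survival gs x <= 1.
Proof.
elim: gs x => [x _|g gs IH x /= /andP[/asboolP rg rgs]] /=; first by rewrite lern1 leq_b1.
case: ifP => // _; rewrite -[leRHS](step_const 1 x rg).
by apply: step_le => y; apply: IH.
Qed.

(** The target is visited at all with probability 1 - survival gs x, and from the
    first visit on, the remaining steps bring at most B visits on average. *)
Lemma visits_survival (B : R) gs x : all (fun g => `[< regular_pos g >]) gs ->
  (forall k, visits (drop k gs) v <= B) ->
  visits gs x <= B * (1 - survival gs x).
Proof.
elim: gs x => [x _ /(_ 0%N)|g gs IH x /= /andP[/asboolP rg rgs] hB].
  rewrite /= /point eqxx => B1.
  by case: eqVneq => _ /=; rewrite ?subrr ?subr0 ?mulr0 ?mulr1.
have [->|xv] := eqVneq x v; first by rewrite subr0 mulr1; apply: (hB 0%N).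
rewrite /point (negbTE xv) add0r.
have -> : B * (1 - step g (survival gs) x) =
    step g (fun y => B * (1 + -1 * survival gs y)) x.
  by rewrite stepZ (stepD g (fun=> 1)) stepZ step_const // mulN1r.
apply: step_le => y; rewrite mulN1r; apply: IH => // k.
exact: (hB k.+1).
Qed.

Lemma step_sum g (I : Type) (r : seq I) (F : I -> V -> R) x :
  step g (fun y => \sum_(i <- r) F i y) x = \sum_(i <- r) step g (F i) x.
Proof.
rewrite /step exchange_big; apply: eq_bigr => y _ /=.
by rewrite mulr_sumr.
Qed.

Lemma visitsE gs x :
  visits gs x = \sum_(0 <= k < (size gs).+1) walk (take k gs) (point R v) x.
Proof.
elim: gs x => [x|g gs IH x] /=; first by rewrite big_nat1.
rewrite big_nat_recl //=; congr (_ + _); rewrite -step_sum.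
by congr step; apply/funext => y; exact: IH.
Qed.

Lemma lifetimeE gs x :
  lifetime (fun x => (x != v)%:R) gs x =
  \sum_(0 <= k < (size gs).+1) survival (take k gs) x.
Proof.
elim: gs x => [x|g gs IH x] /=; first by rewrite big_nat1.
rewrite big_nat_recl //=; case: eqVneq => _ /=; first by rewrite big1 ?addr0.
by congr (_ + _); rewrite -step_sum; congr step; apply/funext => y; exact: IH.
Qed.

Lemma lifetime_le h (C : R) gs x : all (fun g => `[< regular_pos g >]) gs ->
  (forall y, h y <= C * (y != v)%:R) ->
  lifetime h gs x <= (size gs)%:R + C * survival gs x.
Proof.
move=> + hC; elim: gs x => [x _|g gs IH x /= /andP[/asboolP rg rgs]] /=.
  by rewrite add0r.
case: ifP => _; first by rewrite mulr0 addr0.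
rewrite -[(size gs).+1%:R]natr1 [_ + 1]addrC -addrA lerD2l.
rewrite -[(size gs)%:R](step_const _ x rg) -stepZ -stepD.
by apply: step_le => y; apply: IH.
Qed.

(** A window of W steps is survived with probability at most 1 - q, and the
    number C = W / q solves C = W + (1 - q) C. *)
Lemma lifetime_bound (P : pred (sgraph V)) (W : nat) (q : R) gs x :
  (forall g, P g -> regular_pos g) ->
  (0 < W)%N -> 0 < q -> q <= 1 ->
  (forall gs' y, all P gs' -> size gs' = W -> survival gs' y <= 1 - q) ->
  all P gs ->
  lifetime (fun x => (x != v)%:R) gs x <= W%:R / q.
Proof.
move=> Preg W0 q0 q1 hW.
have reg gs' : all P gs' -> all (fun g => `[< regular_pos g >]) gs'.
  by apply: sub_all => g Pg; apply/asboolP/Preg.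
have C0 : W%:R <= W%:R / q by rewrite ler_pdivlMr // ler_piMr.
have [n] := ubnP (size gs); elim: n => // n IH in gs x * => sz Pgs.
have [lt|ge] := ltnP (size gs) W.
  apply: le_trans C0; apply: (@le_trans _ _ ((size gs)%:R + 1 * survival gs x)).
    by apply: lifetime_le (reg _ Pgs) _ => y; rewrite mul1r.
  rewrite mul1r; apply: (@le_trans _ _ ((size gs)%:R + 1)).
    by rewrite lerD2l survival_le1 // reg.
  by rewrite natr1 ler_nat.
have szt : size (take W gs) = W by rewrite size_takel.
move: Pgs; rewrite -{1}(cat_take_drop W gs) all_cat => /andP[Pt Pd].
rewrite -(cat_take_drop W gs) /lifetime foldr_cat -!/(lifetime _ _).
apply: le_trans (lifetime_le (C := W%:R / q) _ (reg _ Pt) _) _ => [y|].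
  have [yv|yv] := eqVneq y v; last first.
    by rewrite mulr1; apply: IH => //; rewrite size_drop; lia.
  by rewrite mulr0 yv; case: (drop W gs) => [|? ?] /=; rewrite eqxx.
rewrite szt; have := hW _ x Pt szt; move: (survival _ _) => s hs.
have WE : W%:R / q = W%:R + W%:R / q * (1 - q) :> R.
  by field; rewrite gt_eqF.
by rewrite [leRHS]WE lerD2l ler_wpM2l // divr_ge0 // ltW.
Qed.

End Hitting.

Section Bounds.
Variables (R : realType) (V : finType) (D : nat) (c eps : R).
Hypotheses (c_gt0 : 0 < c) (eps_ge0 : 0 <= eps) (eps_le : eps <= 4^-1).
Hypothesis V2 : (2 <= #|V|)%N.
Implicit Types (gs : seq (sgraph V)).
Notation adm := (@admissible R V D c eps).

Definition decay_const : R := (4 / rate D c) `^ (1 - 2 * eps)^-1.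

Definition power_sum (e : R) (N : nat) : R :=
  \sum_(1 <= t < N.+1) (t%:R `^ (1 + 2 * e))^-1.

Lemma power_sum_le e (N M : nat) : (N <= M)%N -> power_sum e N <= power_sum e M.
Proof.
move=> NM; rewrite /power_sum [leRHS](big_cat_nat (n := N.+1)) //= lerDl.
by apply: sumr_ge0 => t _; rewrite invr_ge0 powR_ge0.
Qed.

Let V0 : (0 < #|V|)%N. Proof. by apply: leq_trans V2. Qed.

Lemma kernel_decay gs u v : all adm gs -> (0 < size gs)%N ->
  `|walk gs (point R v) u - #|V|%:R^-1| <=
  decay_const / (size gs)%:R `^ (1 + 2 * eps).
Proof.
have [e0 e4] := (eps_ge0, eps_le).
move=> ags s0; have := walk_pointwise c_gt0 eps_ge0 eps_le u v V0 ags s0.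
set e := `|_|; set gam := 1 - 2 * eps => h.
have e_ge0 : 0 <= e by rewrite normr_ge0.
have gam0 : 0 < gam by rewrite /gam; lra.
have r0 := rate_gt0 D c_gt0.
have s1 : 1 <= (size gs)%:R :> R by rewrite ler1n.
have -> : e = (e `^ gam) `^ gam^-1 by rewrite -powRrM divff ?gt_eqF // powRr1.
apply: (@le_trans _ _ ((4 / rate D c / (size gs)%:R) `^ gam^-1)).
  apply: ge0_ler_powR; rewrite ?nnegrE ?powR_ge0 ?invr_ge0 ?(ltW gam0) //.
  by rewrite !divr_ge0 // ltW.
rewrite powRM ?invr_ge0 ?divr_ge0 ?(ltW r0) //.
rewrite -/gam -/decay_const ler_wpM2l ?powR_ge0 //.
rewrite -powR_inv1 // -powRrM mulN1r powRN lef_pV2 ?posrE ?powR_gt0 ?ltr0n //.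
apply: ler_powR => //; rewrite -[leRHS]mul1r ler_pdivlMr // /gam; nra.
Qed.

(** If the distance e from the kernel to 1 / n exceeded 1 / (2 n), then
    e ^ gam would exceed (1 / (2 n)) ^ gam >= 1 / (2 n), against the bound of order
    1 / t on e ^ gam. *)
Lemma kernel_lower gs u v : all adm gs ->
  8 / rate D c * #|V|%:R <= (size gs)%:R ->
  (2 * #|V|%:R)^-1 <= walk gs (point R v) u.
Proof.
have [e0 e4] := (eps_ge0, eps_le).
move=> ags sz; have r0 := rate_gt0 D c_gt0.
have n2 : 2 <= #|V|%:R :> R by rewrite ler_nat.
have n0 : 0 < #|V|%:R :> R by lra.
have s0 : 0 < (size gs)%:R :> R by apply: lt_le_trans sz; rewrite !mulr_gt0 ?invr_gt0.
have := walk_pointwise c_gt0 eps_ge0 eps_le u v V0 ags.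
rewrite -(ltr0n R) s0 => /(_ isT).
set n := #|V|%:R : R; set p := walk _ _ _; set gam := 1 - 2 * eps => h.
suff : `|p - n^-1| <= (2 * n)^-1.
  rewrite ler_norml => /andP[+ _].
  have -> : n^-1 = 2 * (2 * n)^-1 by field; rewrite gt_eqF.
  lra.
rewrite leNgt; apply/negP => lt.
have q0 : 0 < (2 * n)^-1 by rewrite invr_gt0 mulr_gt0.
have q1 : (2 * n)^-1 <= 1 by rewrite invf_le1 ?mulr_gt0 //; rewrite /n; lra.
have : (2 * n)^-1 `^ gam < `|p - n^-1| `^ gam.
  by apply: gt0_ltr_powR; rewrite ?nnegrE ?(ltW q0) // /gam; lra.
have : (2 * n)^-1 <= (2 * n)^-1 `^ gam.
  by apply: ger1_powR; rewrite ?q0 // /gam; lra.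
have : 4 / rate D c / (size gs)%:R <= (2 * n)^-1.
  rewrite ler_pdivrMr // [leRHS]mulrC ler_pdivlMr ?mulr_gt0 //.
  by apply: le_trans sz; rewrite -/n; lra.
lra.
Qed.

Lemma visits_le gs u v (N : nat) : all adm gs -> (size gs <= N)%N ->
  visits R v gs u <= 1 + N%:R / #|V|%:R + decay_const * power_sum eps N.
Proof.
move=> ags sN; rewrite visitsE big_ltn // take0 -addrA.
have c0 : 0 <= decay_const by rewrite powR_ge0.
apply: lerD; first by rewrite /= /point lern1 leq_b1.
apply: (@le_trans _ _ ((size gs)%:R / #|V|%:R +
    decay_const * power_sum eps (size gs))); last first.
  apply: lerD; last by rewrite ler_wpM2l // power_sum_le.
  by rewrite ler_wpM2r ?invr_ge0 // ler_nat.
have -> : (size gs)%:R / #|V|%:R = \sum_(1 <= t < (size gs).+1) #|V|%:R^-1 :> R.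
  by rewrite sumr_const_nat subn1 /= -[RHS]mulr_natl.
rewrite /power_sum mulr_sumr -big_split /=.
apply: ler_sum_nat => t; rewrite ltnS => /andP[t0 ts].
have szt : size (take t gs) = t by rewrite size_takel.
have at_ : all adm (take t gs).
  by have := ags; rewrite -{1}(cat_take_drop t gs) all_cat => /andP[].
have := kernel_decay u v at_; rewrite szt => /(_ t0).
by move/(le_trans (ler_norm _)); rewrite lerBlDl.
Qed.

(** By time time_scale * #|V| every transition probability has come within
    1 / (2 n) of 1 / n, see [kernel_lower]. *)
Definition time_scale : nat := (Num.truncn (8 / rate D c)).+1.

Lemma visits_ge gs u v : all adm gs -> size gs = (2 * (time_scale * #|V|))%N ->
  2^-1 <= visits R v gs u.
Proof.
move=> ags sz; rewrite visitsE sz; set m := time_scale; set n := #|V|.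
have n0 : 0 < n%:R :> R by rewrite ltr0n.
(* Only the m n last times count, each for at least 1 / (2 n). *)
rewrite (big_cat_nat (n := (m * n).+1)) //=; last by rewrite ltnS; lia.
apply: (@le_trans _ _ (\sum_((m * n).+1 <= t < (2 * (m * n)).+1) (2 * n%:R)^-1)).
  rewrite sumr_const_nat -[leRHS]mulr_natr.
  have -> : ((2 * (m * n)).+1 - (m * n).+1 = m * n)%N by lia.
  have m1 : 1 <= m%:R :> R by rewrite ler1n.
  rewrite natrM; have -> : (2 * n%:R)^-1 * (m%:R * n%:R) = 2^-1 * m%:R :> R.
    by field; rewrite gt_eqF.
  lra.
rewrite -[leLHS]add0r; apply: lerD.
  apply: sumr_ge0 => t _; apply: walk_ge0 => x; exact: point_ge0.
apply: ler_sum_nat => t; rewrite ltnS => /andP[t0 ts].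
have szt : size (take t gs) = t by rewrite size_takel // sz.
apply: kernel_lower.
  by have := ags; rewrite -{1}(cat_take_drop t gs) all_cat => /andP[].
rewrite szt; apply: (@le_trans _ _ (m%:R * n%:R)).
  by rewrite ler_wpM2r // ltW // truncnS_gt.
by rewrite -natrM ler_nat ltnW.
Qed.

(** Bounds the expected number of visits to v of a walk that starts at v and
    runs for at most 2 * time_scale * #|V| steps. *)
Definition visits_bound : R :=
  1 + (2 * time_scale)%:R +
  decay_const * power_sum eps (2 * (time_scale * #|V|)).

(** By time 2 m n the walk has made at least 1/2 visit to v on average, and after
    its first visit it makes at most visits_bound more on average; hence v is
    hit with probability at least 1 / (2 visits_bound) in every such window. *)
Lemma survival_window gs u v : all adm gs ->
  size gs = (2 * (time_scale * #|V|))%N ->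
  survival R v gs u <= 1 - (2 * visits_bound)^-1.
Proof.
move=> ags sz.
have B1 : 1 <= visits_bound.
  rewrite /visits_bound -addrA lerDl addr_ge0 // mulr_ge0 ?powR_ge0 //.
  by apply: sumr_ge0 => t _; rewrite invr_ge0 powR_ge0.
have hB k : visits R v (drop k gs) v <= visits_bound.
  apply: le_trans (visits_le v v (N := 2 * (time_scale * #|V|)) _ _) _.
  - by have := ags; rewrite -{1}(cat_take_drop k gs) all_cat => /andP[].
  - by rewrite size_drop sz leq_subr.
  rewrite /visits_bound lerD2r lerD2l mulnA natrM mulfK //.
  by rewrite pnatr_eq0 -lt0n.
have reg : all (fun g => `[< regular_pos g >]) gs.
  apply: sub_all ags => g ag; apply/asboolP; exact: admissible_regular ag.
have := le_trans (visits_ge u v ags sz) (visits_survival u reg hB).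
rewrite -ler_pdivrMl ?(lt_le_trans ltr01) // invfM mulrC.
lra.
Qed.

Lemma expected_lifetime gs u v : all adm gs ->
  lifetime v (fun x => (x != v)%:R) gs u <=
  4 * time_scale%:R * visits_bound * #|V|%:R.
Proof.
move=> ags.
have B1 : 1 <= visits_bound.
  rewrite /visits_bound -addrA lerDl addr_ge0 // mulr_ge0 ?powR_ge0 //.
  by apply: sumr_ge0 => t _; rewrite invr_ge0 powR_ge0.
have B0 : 0 < visits_bound by apply: lt_le_trans B1.
apply: le_trans (lifetime_bound (P := adm) (W := 2 * (time_scale * #|V|))
  (q := (2 * visits_bound)^-1) u _ _ _ _ _ ags) _.
- by move=> g; apply: admissible_regular.
- by rewrite !muln_gt0 V0.
- by rewrite invr_gt0 mulr_gt0.
- by rewrite invf_le1 ?mulr_gt0 //; lra.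
- by move=> gs' y; apply: survival_window.
by rewrite invrK !natrM le_eqVlt; apply/orP; left; apply/eqP; ring.
Qed.

End Bounds.

(** * Avoidance probabilities and hitting times of the process *)

Section Process.
Variables (R : realType) (V : finType) (G : nat -> sgraph V).
Variables (d : measure_display) (Omega : measurableType d).
Variables (P : V -> probability Omega R) (X : nat -> Omega -> V).
Hypothesis walkX : lazy_random_walk P X G.
Variable v : V.

Let mX t x : measurable (X t @^-1` [set x]).
Proof. by case: walkX. Qed.

Lemma measurable_path_event t x : measurable (path_event X t x).
Proof.
rewrite (_ : path_event X t x =
    \bigcap_(i in [set i | (i <= t)%N]) (X i @^-1` [set x i])); last first.
  by apply/seteqP; split.
by apply: bigcap_measurable => //; exists 0%N.
Qed.

Definition avoid (k m : nat) : set Omega :=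
  [set w | forall i : nat, (k <= i <= k + m)%N -> X i w <> v].

Lemma measurable_avoid k m : measurable (avoid k m).
Proof.
rewrite (_ : avoid k m =
    \bigcap_(i in [set i | (k <= i <= k + m)%N]) ~` (X i @^-1` [set v])).
  apply: bigcap_measurable => [|i _]; last exact: measurableC.
  by exists k; rewrite /= leqnn leq_addr.
by apply/seteqP; split.
Qed.

Lemma survival_target gs : survival R v gs v = 0.
Proof. by case: gs => [|g gs] /=; rewrite eqxx. Qed.

Definition update (x : nat -> V) (k : nat) (y : V) : nat -> V :=
  fun i => if i == k then y else x i.

Lemma path_event_update k x y :
  path_event X k.+1 (update x k.+1 y) =
  path_event X k x `&` (X k.+1 @^-1` [set y]).
Proof.
rewrite /update; apply/seteqP; split=> w.
  move=> h; split=> [i ik|].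
    by rewrite (h i (leqW ik)) ifN // neq_ltn ltnS ik.
  by rewrite /= (h k.+1) // eqxx.
move=> [h1 h2] i; rewrite leq_eqVlt => /predU1P[->|ik].
  by rewrite eqxx; exact: h2.
by rewrite ifN ?h1 // neq_ltn ik.
Qed.

(** Induction on m, conditioning on the next state: only prefixes of trajectories
    occur, so that the Markov property is used exactly as it is given. *)
Lemma path_event_avoid u m k x :
  P u (path_event X k x `&` avoid k m) =
  (P u (path_event X k x) *
   (survival R v (map G (iota k.+1 m)) (x k))%:E)%E.
Proof.
elim: m k x => [|m IH] k x; have [xv|xv] := eqVneq (x k) v.
- rewrite xv survival_target mule0 (_ : _ `&` _ = set0) ?measure0 //.
  apply/seteqP; split=> // w [h1 h2]; case: (h2 k); first by rewrite leqnn leq_addr.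
  by rewrite -xv; apply: h1.
- rewrite /= xv mule1; congr (P u _); apply/seteqP; split=> [w []//|w h].
  split=> // i; rewrite addn0 -eqn_leq => /eqP <-; rewrite (h k) //.
  exact/eqP.
- rewrite xv survival_target mule0 (_ : _ `&` _ = set0) ?measure0 //.
  apply/seteqP; split=> // w [h1 h2]; case: (h2 k); first by rewrite leqnn leq_addr.
  by rewrite -xv; apply: h1.
pose F y := path_event X k.+1 (update x k.+1 y) `&` avoid k.+1 m.
have mF y : measurable (F y).
  by apply: measurableI; [exact: measurable_path_event|exact: measurable_avoid].
have -> : path_event X k x `&` avoid k m.+1 =
    \bigcup_(y in [set` index_enum V]) F y.
  apply/seteqP; split=> w.
    move=> [h1 h2]; exists (X k.+1 w); first exact: mem_index_enum.
    rewrite /F path_event_update; split=> // i /andP[i1 i2]; apply: h2.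
    by rewrite (ltnW i1) /= -addSnnS.
  move=> [y _ []]; rewrite path_event_update => -[h1 h2] h3; split=> // i /andP[i1 i2].
  move: i1; rewrite leq_eqVlt => /predU1P[<-|i1].
    by rewrite (h1 k) //; apply/eqP.
  by apply: h3; rewrite i1 addSnnS.
have trivF : trivIset [set` index_enum V] F.
  apply/trivIsetP => y z _ _ yz; apply/seteqP; split=> // w.
  rewrite /F !path_event_update => -[[[_ h1] _] [[_ h2] _]].
  by move: yz; rewrite -h1 -h2 eqxx.
rewrite (measure_fin_bigcup _ (finite_seq _) trivF (fun y _ => mF y)).
rewrite -fsbig_seq ?index_enum_uniq //= (negbTE xv) /step -sumEFin.
rewrite ge0_sume_distrr; last first.
  by move=> y _; rewrite lee_fin mulr_ge0 ?lazy_step_ge0 ?survival_ge0.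
apply: eq_bigr => y _; rewrite /F IH; case: walkX => _ _ ->.
have -> : path_event X k (update x k.+1 y) = path_event X k x.
  apply/seteqP; split=> w h i ik; have := h i ik;
  by rewrite /update ifN // neq_ltn ltnS ik.
rewrite /update eqxx ifN ?neq_ltn ?ltnS ?leqnn //.
by rewrite EFinM muleA.
Qed.

(** The process starts at u up to a null event only, hence an inequality. *)
Lemma prob_avoid u m :
  (P u (avoid 0 m) <= (survival R v (map G (iota 1 m)) u)%:E)%E.
Proof.
have P0 : P u (path_event X 0 (fun=> u)) = 1%E.
  case: walkX => _ h _; rewrite -[RHS](h u); congr (P u _).
  apply/seteqP; split=> w; first by move=> /(_ 0%N isT).
  by move=> h0 i; rewrite leqn0 => /eqP ->.
have mE := measurable_path_event 0 (fun=> u).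
have mA := measurable_avoid 0 m.
have := path_event_avoid u m 0 (fun=> u); rewrite P0 mul1e => <-.
have PC : P u (~` path_event X 0 (fun=> u)) = 0%E.
  by rewrite probability_setC // P0 subee.
have mEA := measurableI _ _ mE mA; have mC := measurableC mE.
apply: (@le_trans _ _ (P u ((path_event X 0 (fun=> u) `&` avoid 0 m) `|`
    ~` path_event X 0 (fun=> u)))); last first.
  by apply: le_trans (measureU2 _ mEA mC) _; rewrite [X in (_ + X)%E]PC adde0.
apply: le_measure; rewrite ?inE //; first exact: measurableU.
by move=> w hw; have [h|h] := pselect (path_event X 0 (fun=> u) w); [left|right].
Qed.

Lemma sum_ltn (N t : nat) : (\sum_(0 <= i < N) (i < t) <= minn N t)%N.
Proof.
elim: N => [|N IH]; first by rewrite big_geq.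
rewrite big_nat_recr //=; move: IH; move: (bigop.body _ _ _) => s.
by case: (ltnP N t) => h /=; rewrite /minn; case: ltnP; case: ltnP; lia.
Qed.

(** A nonnegative integer is the number of smaller ones; this tail-sum form
    also makes the hitting time measurable. *)
Lemma hitting_timeE w :
  hitting_time R X v w = (\sum_(0 <= t <oo) (\1_(avoid 0 t) w)%:E)%E.
Proof.
have t0 (t : nat) : (0 <= (\1_(avoid 0 t) w)%:E :> \bar R)%E.
  by rewrite lee_fin indicE.
have ge (N : nat) : (forall i, (i < N)%N -> X i w <> v) ->
    (N%:R%:E <= \sum_(0 <= t <oo) (\1_(avoid 0 t) w)%:E :> \bar R)%E.
  move=> h; apply: le_trans (nneseries_lim_ge N _); last by move=> *; exact: t0.
  rewrite sumEFin lee_fin -[leLHS](_ : \sum_(0 <= i < N) 1 = _); last first.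
    by rewrite sumr_const_nat subn0.
  apply: ler_sum_nat => i /andP[_ iN]; rewrite indicE mem_set //.
  by move=> j /= jle; apply: h; rewrite (leq_ltn_trans jle).
apply/eqP; rewrite eq_le; apply/andP; split.
  have [[t Xt]|nh] := pselect (exists t, X t w = v).
    pose p t := `[< X t w = v >].
    have ep : exists t, p t by exists t; apply/asboolP.
    have [s /asboolP Xs smin] := ex_minnP ep.
    apply: (@le_trans _ _ (s%:R%:E)).
      by apply: ereal_inf_lbound; exists s.
    apply: ge => i si Xi; have : p i by apply/asboolP.
    by move/smin; rewrite leqNgt si.
  rewrite [leRHS]eq_infty ?leey // => r.
  have := truncnS_gt r => /ltW rN.
  apply: (@le_trans _ _ ((Num.truncn r).+1%:R%:E)); first by rewrite lee_fin.
  by apply: ge => i _ Xi; apply: nh; exists i.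
apply: le_ereal_inf_tmp => _ [t /= Xt <-].
apply: lime_le; first by apply: is_cvg_nneseries => *; exact: t0.
apply: nearW => N; rewrite sumEFin lee_fin.
apply: (@le_trans _ _ (\sum_(0 <= i < N) (i < t)%:R)).
  apply: ler_sum => i _; rewrite indicE ler_nat.
  have [it|ti] := ltnP i t; first exact: leq_b1.
  by rewrite memNset // => h; apply: (h t _ Xt); rewrite /= add0n.
rewrite -natr_sum ler_nat; apply: leq_trans (sum_ltn N t) _; exact: geq_minr.
Qed.

Lemma expected_hitting_time_le u (C : R) :
  (forall N, lifetime v (fun x => (x != v)%:R) (map G (iota 1 N)) u <= C) ->
  (expected_hitting_time P X u v <= C%:E)%E.
Proof.
move=> hC; rewrite /expected_hitting_time.
under eq_integral do rewrite hitting_timeE.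
rewrite integral_nneseries; first last.
- by move=> n w _; rewrite lee_fin indicE.
- by move=> n; apply/measurable_EFinP/measurable_indic/measurable_avoid.
- exact: measurableT.
have term n : (\int[P u]_w (\1_(avoid 0 n) w)%:E = P u (avoid 0 n))%E.
  by rewrite integral_indic ?setIT //; exact: measurable_avoid.
apply: lime_le.
  by apply: is_cvg_nneseries => n _ _; rewrite term measure_ge0.
apply: nearW => N.
apply: (@le_trans _ _ (\sum_(0 <= n < N.+1)
    survival R v (take n (map G (iota 1 N))) u)%:E); last first.
  by rewrite lee_fin; apply: le_trans (hC N); rewrite lifetimeE size_map size_iota.
rewrite -sumEFin big_nat_recr //= -[leLHS]adde0; apply: leeD; last first.
  by rewrite lee_fin survival_ge0.
rewrite big_nat [leRHS]big_nat; apply: lee_sum => n /andP[_ nN].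
rewrite term -map_take take_iota (minn_idPl (ltnW nN)).
exact: prob_avoid.
Qed.

End Process.

(** * Sums of inverse powers *)

Section PowerSums.
Variable R : realType.

Lemma ln_increment (t : R) : 0 < t -> (t + 1)^-1 <= ln (t + 1) - ln t.
Proof.
move=> t0; have t1 : 0 < t + 1 by rewrite addr_gt0.
have := @le_ln1Dx R (- (t + 1)^-1).
rewrite ltrN2 invf_lt1 // ltrDr => /(_ t0).
have -> : 1 - (t + 1)^-1 = t / (t + 1) by field; rewrite gt_eqF.
rewrite ln_div ?posrE //; lra.
Qed.

(** With s = t + 1, this is (s / t) ^ r >= 1 + r / s, from exp x >= 1 + x and
    [ln_increment]. *)
Lemma power_increment (r t : R) : 0 <= r -> 0 < t ->
  r * ((t + 1) `^ (1 + r))^-1 <= (t `^ r)^-1 - ((t + 1) `^ r)^-1.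
Proof.
move=> r0 t0; have t1 : 0 < t + 1 by rewrite addr_gt0.
rewrite powR1D ?(ltW t1) // invfM.
set a := t `^ r; set b := (t + 1) `^ r.
have a0 : 0 < a by rewrite powR_gt0.
have b0 : 0 < b by rewrite powR_gt0.
rewrite -(ler_pM2r b0).
have -> : (a^-1 - b^-1) * b = b / a - 1 by field; rewrite !gt_eqF.
have -> : r * ((t + 1)^-1 / b) * b = r * (t + 1)^-1.
  by field; rewrite !gt_eqF.
have -> : b / a = expR (r * (ln (t + 1) - ln t)).
  by rewrite /a /b /powR !gt_eqF // -expRN -expRD; congr expR; ring.
rewrite lerBrDl; apply: le_trans (expR_ge1Dx _).
by rewrite lerD2l ler_wpM2l // ln_increment.
Qed.

Lemma power_sum_bound (e : R) (N : nat) : 0 < e ->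
  power_sum e N <= 1 + (2 * e)^-1.
Proof.
move=> e0; have e2 : 0 < 2 * e by rewrite mulr_gt0.
suff h M : power_sum e M.+1 <=
    1 + (2 * e)^-1 * (1 - (M.+1%:R `^ (2 * e))^-1).
  apply: le_trans (power_sum_le e (leqnSn N)) _; apply: le_trans (h N) _.
  rewrite lerD2l; apply: ler_piMr; first by rewrite invr_ge0 ltW.
  by rewrite gerBl invr_ge0 powR_ge0.
elim: M => [|M IH].
  by rewrite /power_sum big_nat1 !powR1 invr1 subrr mulr0 addr0.
rewrite /power_sum big_nat_recr //= -/(power_sum e M.+1).
have := power_increment (ltW e2) (ltr0Sn R M); rewrite natr1.
rewrite [X in X <= _]mulrC -ler_pdivlMr // [X in _ <= X]mulrC => h.
apply: le_trans (lerD IH h) _.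
by rewrite -addrA -mulrDr addrA subrK.
Qed.

Lemma harmonic_sum_bound (N : nat) : power_sum 0 N.+1 <= 1 + ln N.+1%:R :> R.
Proof.
elim: N => [|N IH].
  by rewrite /power_sum big_nat1 powR1 invr1 ln1 addr0.
rewrite /power_sum big_nat_recr //= -/(power_sum 0 N.+1).
rewrite mulr0 addr0 powRr1 //.
have := ln_increment (ltr0Sn R N); rewrite natr1; move: IH.
move: (ln N.+2%:R) (ln N.+1%:R) (N.+2%:R^-1 : R) (power_sum _ _) => a b x y.
by lra.
Qed.

Lemma ln_ge_half (n : nat) : (2 <= n)%N -> 2^-1 <= ln n%:R :> R.
Proof.
move=> n2; apply: (@le_trans _ _ (ln 2)).
  by have := ln_increment (@ltr01 R); rewrite ln1 subr0.
by rewrite ler_ln ?posrE ?ltr0n ?ler_nat //; exact: leq_trans n2.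
Qed.

End PowerSums.

(** * Mixing time and the three bounds *)

Section Mixing.
Variables (R : realType) (V : finType) (D : nat) (c eps : R).
Hypotheses (c_gt0 : 0 < c) (eps_ge0 : 0 <= eps) (eps_le : eps <= 4^-1).
Hypothesis V2 : (2 <= #|V|)%N.
Implicit Type (G : nat -> sgraph V).
Notation adm := (@admissible R V D c eps).

Lemma tprobE G t u v :
  tprob R G t u v = walk (map G (iota 1 t)) (point R v) u.
Proof.
have recur s w : tprob R G s.+1 u w =
    \sum_x tprob R G s u x * lazy_step R (G s.+1) x w.
  rewrite /tprob /= mxE (reindex enum_rank) /=; last first.
    by apply: onW_bij; exact: enum_rank_bij.
  by apply: eq_bigr => x _; rewrite mxE !enum_rankK.
suff h s f : \sum_x tprob R G s u x * f x = walk (map G (iota 1 s)) f u.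
  by rewrite -h sum_point.
elim: s f => [|s IH] f.
  rewrite -[RHS](sum_point u) /tprob /=; apply: eq_bigr => x _.
  rewrite mxE mulrC (inj_eq enum_rank_inj) /point; congr (_ * _).
  by rewrite eq_sym.
rewrite -addn1 iotaD map_cat walk_cat -IH /= add1n addn1.
under eq_bigr do rewrite recur mulr_suml.
rewrite exchange_big; apply: eq_bigr => x _ /=.
by rewrite mulr_sumr; apply: eq_bigr => y _; rewrite mulrA.
Qed.

Lemma walk_rev gs u v : all adm gs ->
  walk gs (point R v) u = walk (rev gs) (point R u) v.
Proof.
move=> ags; rewrite -(sum_point u (walk gs _)) (walk_adjoint _ _ ags).
by rewrite -[RHS]sum_point; apply: eq_bigr => x _; rewrite mulrC.
Qed.

Let V0 : (0 < #|V|)%N. Proof. by apply: leq_trans V2. Qed.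

(** At time t, a ^ gam <= 2 / (rate (t + 1)), and a > 1 / (9 n) would give
    a ^ gam >= 1 / (9 n ^ gam); the rows of the product of the steps are walks run
    along the reversed sequence. *)
Lemma tmix_le G : (forall t, (1 <= t)%N -> adm (G t)) ->
  (tmix R G <= (18 / rate D c * #|V|%:R `^ (1 - 2 * eps))%:E)%E.
Proof.
have [e0 e4] := (eps_ge0, eps_le).
move=> aG; have r0 := rate_gt0 D c_gt0; have r1 := rate_le1 D c.
set n := #|V|%:R : R; set gam := 1 - 2 * eps.
have n0 : 0 < n by rewrite ltr0n.
have N0 : 0 < n `^ gam by rewrite powR_gt0.
set T := 18 / rate D c * n `^ gam.
have T0 : 0 <= T by rewrite !mulr_ge0 ?invr_ge0 // ltW.
apply: ge_ereal_inf; exists ((Num.truncn T)%:R%:E); last first.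
  by rewrite lee_fin truncn_le.
exists (Num.truncn T) => //= u; set t := Num.truncn T.
have tT : T < t.+1%:R by exact: truncnS_gt.
pose gs := map G (iota 1 t).
have ags : all adm gs.
  rewrite all_map; apply/allP => s; rewrite mem_iota => /andP[s1 _].
  exact: aG.
have sz : size gs = t by rewrite size_map size_iota.
pose f := walk (rev gs) (point R u).
have fE x : tprob R G t u x = f x by rewrite tprobE walk_rev.
have -> : l2norm_pi (fun x => rho R G t u x - 1) = Num.sqrt (n * deviation f).
  rewrite /l2norm_pi /deviation /sqnorm mulr_sumr; congr Num.sqrt.
  apply: eq_bigr => x _; rewrite /rho /stat_pi fE -/n.
  by field; rewrite gt_eqF.
have -> : 3^-1 = Num.sqrt (3^-1 ^+ 2) :> R by rewrite sqrtr_sqr ger0_norm.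
apply: ler_wsqrtr; rewrite mulrC -ler_pdivlMr // leNgt; apply/negP.
set q := 3^-1 ^+ 2 / n => lt.
have q0 : 0 < q by rewrite divr_gt0 // exprn_gt0.
have lt' : q `^ gam < deviation f `^ gam.
  by apply: gt0_ltr_powR; rewrite ?nnegrE ?(ltW q0) ?deviation_ge0 // /gam; lra.
have arev : all adm (rev gs) by rewrite all_rev.
have dec := walk_decay c_gt0 eps_ge0 eps_le u V0 arev.
rewrite size_rev sz -/gam -/f in dec.
have qn : 9^-1 <= q `^ gam * n `^ gam.
  rewrite -powRM ?(ltW q0) ?(ltW n0) //.
  rewrite /q divfK ?gt_eqF //; have -> : 9^-1 = 3^-1 ^+ 2 :> R by field.
  by apply: ger1_powR; rewrite ?exprn_gt0 ?exprn_ile1 ?invf_le1 //= ?ler1n // /gam; lra.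
have big : 9 * n `^ gam < 1 + rate D c / 2 * t%:R.
  have : rate D c / 2 * T < rate D c / 2 * (t%:R + 1).
    by rewrite ltr_pM2l ?divr_gt0 // natr1.
  have -> : rate D c / 2 * T = 9 * n `^ gam.
    by rewrite /T; field; rewrite gt_eqF.
  lra.
have : 9^-1 * 9 < deviation f `^ gam * (1 + rate D c / 2 * t%:R).
  apply: (@le_lt_trans _ _ (q `^ gam * (9 * n `^ gam))).
    by rewrite [9 * n `^ gam]mulrC mulrA ler_wpM2r.
  by apply: (ltr_pM _ _ lt' big); rewrite ?powR_ge0 // mulr_ge0 // ltW.
by rewrite mulVf // => h; have := lt_le_trans h dec; rewrite ltxx.
Qed.

(** The degree is positive: otherwise a singleton has empty boundary. *)
Lemma admissible_of_regular_iso (g : sgraph V) :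
  (exists2 d : nat, (d <= D)%N & regular g d) ->
  isoperimetric c (2^-1 + eps) g -> adm g.
Proof.
move=> [d dD reg] iso; apply/asboolP; exists d; split=> //.
rewrite lt0n; apply/eqP => d0; have /card_gt0P[v _] := V0.
have := iso [set v]%SET; rewrite cards1 powR1 mulr1 => /(_ isT).
have n2 : 2 <= #|V|%:R :> R by rewrite ler_nat.
have h : 1 <= #|V|%:R / 2 :> R by lra.
move=> /(_ h); rewrite edge_boundaryE big1 ?leNgt ?c_gt0 // => x _.
rewrite big_pred0 // => y.
by have := reg x; rewrite d0 /deg => /card0_eq /(_ y).
Qed.

End Mixing.

Theorem mainTheorem2 (R : realType) (D : nat) (c eps : R)
    (hc : 0 < c) (heps0 : 0 <= eps) (heps1 : eps <= 4^-1) :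
  exists K : R, 0 < K /\
    forall (V : finType) (G : nat -> sgraph V),
      (2 <= #|V|)%N ->
      (forall t : nat, (1 <= t)%N ->
         exists2 d : nat, (d <= D)%N & regular (G t) d) ->
      (forall t : nat, (1 <= t)%N ->
         forall A : {set V}, (1 <= #|A|)%N -> #|A|%:R <= #|V|%:R / 2 :> R ->
           c * #|A|%:R `^ (2^-1 + eps) <= (edge_boundary (G t) A)%:R) ->
      [/\ (tmix R G <= (K * #|V|%:R `^ (1 - 2 * eps))%:E)%E,
          (forall (u v : V) (t : nat), (1 <= t)%N ->
             `|tprob R G t u v - #|V|%:R^-1| <= K / t%:R `^ (1 + 2 * eps)) &
          (forall (d : measure_display) (Omega : measurableType d)
                  (P : V -> probability Omega R) (X : nat -> Omega -> V),
             lazy_random_walk P X G ->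
             (0 < eps -> (thit P X <= (K * #|V|%:R)%:E)%E) /\
             (eps = 0 -> (thit P X <= (K * #|V|%:R * ln #|V|%:R)%:E)%E))].
Proof.
have r0 := rate_gt0 D hc.
pose m := time_scale D c; pose K2 := decay_const D c eps.
have m0 : 0 <= m%:R :> R by [].
have m1 : 1 <= m%:R :> R by rewrite ler1n.
have K20 : 0 <= K2 by rewrite powR_ge0.
pose K1 := 18 / rate D c.
have K10 : 0 < K1 by rewrite divr_gt0.
pose K3 := 4 * m%:R * (1 + (2 * m)%:R + K2 * (1 + (2 * eps)^-1)).
have K30 : 0 <= K3.
  rewrite mulr_ge0 ?mulr_ge0 // addr_ge0 ?addr_ge0 // mulr_ge0 // addr_ge0 //.
  by rewrite invr_ge0 mulr_ge0.
pose K4 := 4 * m%:R *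
  (2 * (1 + (2 * m)%:R + K2 * (1 + ln (2 * m)%:R)) + K2).
have l0 : 0 <= ln (2 * m)%:R :> R.
  by rewrite ln_ge0 // ler1n muln_gt0.
have K40 : 0 <= K4.
  rewrite mulr_ge0 ?mulr_ge0 // addr_ge0 // mulr_ge0 // addr_ge0 ?addr_ge0 //.
  by rewrite mulr_ge0 // addr_ge0.
exists (K1 + K2 + K3 + K4); split; first lra.
move=> V G V2 hreg hiso; have V0 : (0 < #|V|)%N by apply: leq_trans V2.
have aG t : (1 <= t)%N -> admissible D c eps (G t).
  by move=> t1; apply: admissible_of_regular_iso => //; [exact: hreg|exact: hiso].
have aGs N : all (admissible D c eps) (map G (iota 1 N)).
  rewrite all_map; apply/allP => s; rewrite mem_iota => /andP[s1 _].
  exact: aG.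
have n0 : 0 < #|V|%:R :> R by rewrite ltr0n.
split.
- apply: le_trans (tmix_le hc heps0 heps1 V2 aG) _; rewrite lee_fin.
  by rewrite ler_wpM2r ?powR_ge0 // -/K1; lra.
- move=> u v t t1; rewrite tprobE.
  have szt : size (map G (iota 1 t)) = t by rewrite size_map size_iota.
  have := kernel_decay hc heps0 heps1 V2 u v (aGs t); rewrite szt => /(_ t1) h.
  apply: le_trans h _; rewrite ler_wpM2r ?invr_ge0 ?powR_ge0 // -/K2; lra.
move=> d Omega P X wX.
have hit (C : R) : 4 * m%:R * visits_bound V D c eps * #|V|%:R <= C ->
    (thit P X <= C%:E)%E.
  move=> hC; apply/bigmax_leP; split=> [|u _]; first exact: leNye.
  apply/bigmax_leP; split=> [|v _]; first exact: leNye.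
  apply: (expected_hitting_time_le wX) => N; apply: le_trans hC.
  exact: expected_lifetime.
split=> [eps0|eps0]; apply: hit.
  apply: (@le_trans _ _ (K3 * #|V|%:R)); last by rewrite ler_wpM2r ?(ltW n0) //; lra.
  rewrite ler_wpM2r ?(ltW n0) // ler_wpM2l ?mulr_ge0 // lerD2l ler_wpM2l //.
  exact: power_sum_bound.
set n := #|V|%:R : R.
(* As 1 <= 2 ln n, the constant terms of the bound are absorbed by ln n. *)
have ln2 : 2^-1 <= ln n by apply: ln_ge_half.
apply: (@le_trans _ _ (K4 * n * ln n)); last first.
  rewrite ler_wpM2r ?ler_wpM2r ?(ltW n0) //; lra.
rewrite /K4; set q := 2 * _ + K2.
have -> : 4 * m%:R * q * n * ln n = 4 * m%:R * (q * ln n) * n by ring.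
rewrite ler_wpM2r ?(ltW n0) // ler_wpM2l ?mulr_ge0 // /q {q}.
rewrite /visits_bound -/m -/K2.
have hN : (0 < 2 * (m * #|V|))%N by rewrite !muln_gt0 V0.
have hs := harmonic_sum_bound R (2 * (m * #|V|)).-1.
rewrite prednK // in hs.
have lnE : ln (2 * (m * #|V|))%:R = ln (2 * m)%:R + ln n :> R.
  by rewrite mulnA natrM lnM // posrE ltr0n // muln_gt0.
rewrite lnE in hs.
have hs' : K2 * power_sum eps (2 * (m * #|V|)) <=
    K2 * (1 + (ln (2 * m)%:R + ln n)) by rewrite ler_wpM2l // eps0.
have : 0 <= (1 + (2 * m)%:R + K2 * (1 + ln (2 * m)%:R)) * (2 * ln n - 1).
  rewrite mulr_ge0 //; last lra.
  by rewrite addr_ge0 ?addr_ge0 // mulr_ge0 // addr_ge0.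
move: hs'; move: (power_sum _ _) ((2 * m)%:R : R) (ln (2 * m)%:R) (ln n) => a x b l.
lra.
Qed.
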